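(* $(\mathcal P,+,\cdot)$ is a complete topological ring, and the composition map $\mathcal P\times\mathcal P\to\mathcal P$, $(f,g)\mapsto f\circ g$, is continuous. Also $(\mathcal F,+,\circ)$ is a complete topological ring.
   Context: Let $p$ be a prime, $q$ a power of $p$, and $C$ an algebraically closed field containing $\mathbb F_q$, complete with respect to a non-archimedean absolute value $|\cdot|$; $\Delta_r=\{x\in C:|x|\le r\}$. Let $E=\{mp^n:m,n\in\mathbb Z,m\ge0\}$ with $z^{mp^n}=(z^{1/p^n})^m$. $\mathcal P$ is the set of series $f=\sum_{e\in E}a_ez^e$ ($a_e\in C$) converging at every $z\in C$ (for each $z$ and $r>0$ only finitely many terms exceed $r$ in absolute value); sum and product are formed by expanding and grouping equal exponents. For $g=\sum b_ez^e\in\mathcal P$: $g^m$ is the $m$-fold product for integers $m\ge0$, $g^{p^n}=\sum b_e^{p^n}z^{ep^n}$ for $n\in\mathbb Z$, $g^{mp^n}=(g^m)^{p^n}$, and $f\circ g=\sum_{d\in E}a_dg^d$ (expanded and grouped); this lies in $\mathcal P$ and represents composition of maps. $\mathcal F\subseteq\mathcal P$ is the subset of series whose only exponents are $q^n$, $n\in\mathbb Z$; it is closed under $+$ and $\circ$. $\mathcal P$ carries the bounded-open topology: a subbasis of neighborhoods of $0$ consists of the sets $\mathcal P(r,s)=\{f\in\mathcal P: f(\Delta_r)\subseteq\Delta_s\}$ for $r,s>0$ (translated for other points); $\mathcal F$ has the subspace topology. Completeness refers to the uniform structure of the additive topological group.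
   Formalization: The convention z^{mp^n}=(z^{1/p^n})^m is ill-defined as written (it depends on how the exponent is written as mp^n) and is replaced by z^{mp^n}=(z^{p^n})^m, in agreement with g^{p^n}=∑ b_e^{p^n} z^{ep^n}. *)

(* Defs.v *)
From HB Require Import structures.
From mathcomp Require Import all_boot all_order all_algebra.
From mathcomp Require Import finmap.
From mathcomp Require Import all_classical all_reals all_analysis.

Set Implicit Arguments.
Unset Strict Implicit.
Unset Printing Implicit Defensive.

Import Order.TTheory GRing.Theory Num.Theory.
Local Open Scope classical_set_scope.
Local Open Scope ring_scope.

(* The trivial absolute value is allowed. *)
Record completeNAField (R : realType) := CompleteNAField {
  na_sort :> closedFieldType;
  absv : na_sort -> R;
  absv_ge0 : forall x, 0 <= absv x;
  absv_eq0 : forall x, absv x = 0 <-> x = 0;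
  absvM : forall x y, absv (x * y) = absv x * absv y;
  absvD : forall x y, absv (x + y) <= Num.max (absv x) (absv y);
  absv_complete : forall u : nat -> na_sort,
    (forall eps : R, 0 < eps -> exists N : nat, forall m n : nat,
      (N <= m)%N -> (N <= n)%N -> absv (u m - u n) < eps) ->
    exists l : na_sort, forall eps : R, 0 < eps -> exists N : nat,
      forall n : nat, (N <= n)%N -> absv (u n - l) < eps
}.

Section UnconditionalSums.
Variables (R : realType) (C : completeNAField R) (I : choiceType).
Implicit Types (u w : I -> C) (s t : C).

Definition null_family u : Prop :=
  forall r : R, 0 < r -> finite_set [set i | r < absv (u i)].

Definition is_sum u s : Prop :=
  forall eps : R, 0 < eps -> exists A : {fset I}, forall B : {fset I},
    (A `<=` B)%fset -> absv (\sum_(i <- B) u i - s) < eps.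

(* The sum of u when it exists (in particular for null families), else 0. *)
Definition tsum u : C := xget 0 [set s | is_sum u s].

Lemma absv0 : absv (0 : C) = 0. Proof. exact/absv_eq0. Qed.

Lemma absv1 : absv (1 : C) = 1.
Proof.
have n0 : absv (1 : C) != 0.
  by apply/eqP => /absv_eq0 /eqP; rewrite oner_eq0.
by apply: (mulfI n0); rewrite mulr1 -absvM mulr1.
Qed.

Lemma absvN (x : C) : absv (- x) = absv x.
Proof.
have a1 : absv (-1 : C) = 1.
  apply/eqP; rewrite -sqrp_eq1 ?absv_ge0// expr2 -absvM mulrNN mulr1 absv1 //.
by rewrite -mulN1r absvM a1 mul1r.
Qed.

Lemma absvB (x y : C) : absv (x - y) <= Num.max (absv x) (absv y).
Proof. by rewrite -(absvN y); exact: absvD. Qed.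

Lemma absvD_lt (x y : C) (e : R) : absv x < e -> absv y < e -> absv (x + y) < e.
Proof.
by move=> xe ye; rewrite (le_lt_trans (absvD x y))// gt_max xe ye.
Qed.

Lemma absv_sum_le (s : seq I) (P : pred I) u (r : R) : 0 <= r ->
  (forall i, i \in s -> P i -> absv (u i) <= r) ->
  absv (\sum_(i <- s | P i) u i) <= r.
Proof.
move=> r0 ur; rewrite big_seq_cond.
elim/big_ind : _ => [|x y xr yr|i /andP[]]; first by rewrite absv0.
- by rewrite (le_trans (absvD x y))// ge_max xr yr.
- exact: ur.
Qed.

Lemma is_sum_uniq u s t : is_sum u s -> is_sum u t -> s = t.
Proof.
move=> us ut; apply/eqP; rewrite -subr_eq0; apply/eqP/absv_eq0/eqP.
rewrite eq_le absv_ge0 andbT; apply/ler_addgt0Pl => e e0; rewrite addr0.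
have [A hA] := us e e0; have [B hB] := ut e e0.
have := hA _ (fsubsetUl A B); have := hB _ (fsubsetUr A B).
set x := \sum_(_ <- _) _ => xt xs; rewrite ltW//.
have -> : s - t = (s - x) + (x - t) by rewrite addrA subrK.
by apply: absvD_lt => //; rewrite -absvN opprB.
Qed.

Lemma tsumP u s : is_sum u s -> tsum u = s.
Proof.
by move=> us; apply: (@is_sum_uniq u) => //; rewrite /tsum; case: xgetP => [y -> //|/(_ s)].
Qed.

Lemma is_sumB u w s t : is_sum u s -> is_sum w t ->
  is_sum (fun i => u i - w i) (s - t).
Proof.
move=> us wt e e0; have [A hA] := us e e0; have [B hB] := wt e e0.
exists (A `|` B)%fset => D /[!fsubUset] /andP[/hA h1 /hB h2].
have -> : \sum_(i <- D) (u i - w i) - (s - t) =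
    (\sum_(i <- D) u i - s) - (\sum_(i <- D) w i - t).
  by rewrite sumrB !opprB [t - s]addrC addrACA [- _ + t]addrC.
by apply: absvD_lt => //; rewrite absvN.
Qed.

Lemma null_family_is_sum u : null_family u -> exists s, is_sum u s.
Proof.
move=> nu; have inv0 n : 0 < n.+1%:R^-1 :> R by rewrite invr_gt0.
pose A n := fset_set [set i | n.+1%:R^-1 < absv (u i)].
have inA n i : (i \in A n) = (n.+1%:R^-1 < absv (u i)).
  by rewrite in_fset_set; [apply/idP/idP => [/set_mem|/mem_set]|exact: nu].
have close n (B : {fset I}) : (A n `<=` B)%fset ->
    absv (\sum_(i <- B) u i - \sum_(i <- A n) u i) <= n.+1%:R^-1.
  move=> AB; rewrite (big_fsetID _ (mem (A n)))/=.
  have -> : [fset x in B | x \in A n]%fset = A n.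
    by apply/fsetP => i; rewrite !inE/= andbC; case: (boolP (i \in A n)) => //= /(fsubsetP AB).
  rewrite addrC addrK; apply: absv_sum_le => [|i]; first exact: ltW.
  by rewrite !inE/= => /andP[_]; rewrite inA -leNgt.
have mono m n : (m <= n)%N -> (A m `<=` A n)%fset.
  move=> mn; apply/fsubsetP => i; rewrite !inA; apply: le_lt_trans.
  by rewrite lef_pV2 ?posrE// ler_nat.
have small (e : R) : 0 < e -> exists n : nat, n.+1%:R^-1 < e.
  move=> e0; exists (Num.truncn e^-1).
  by rewrite -[ltRHS]invrK ltf_pV2 ?posrE ?invr_gt0// truncnS_gt.
have [|l hl] := @absv_complete R C (fun n => \sum_(i <- A n) u i).
  move=> e /small[N Ne]; exists N => m n Nm Nn.
  rewrite -(subrK (\sum_(i <- A N) u i) (\sum_(i <- A m) u i)) -addrA.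
  apply: absvD_lt; first exact/(le_lt_trans (close _ _ (mono _ _ Nm))).
  by rewrite -absvN opprB; exact/(le_lt_trans (close _ _ (mono _ _ Nn))).
exists l => e e0; have [N Ne] := small e e0; have [M hM] := hl e e0.
exists (A (maxn N M)) => B AB.
rewrite -(subrK (\sum_(i <- A (maxn N M)) u i) (\sum_(i <- B) u i)) -addrA.
apply: absvD_lt; last by apply: hM; exact: leq_maxr.
apply: (le_lt_trans (close _ _ AB)); apply: le_lt_trans Ne.
by rewrite lef_pV2 ?posrE// ler_nat ltnS leq_maxl.
Qed.

End UnconditionalSums.

Section Series.
Variables (R : realType) (C : completeNAField R) (p : nat).

Definition expE : set rat :=
  [set e | exists (m : nat) (n : int), e = m%:R * p%:R ^ n].

(* Some (m, n) with e = m p^n; the powers below do not depend on this choice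
   when C has characteristic p. *)
Definition expE_repr (e : rat) : nat * int :=
  xget (0%N, 0) [set mn : nat * int | e = mn.1%:R * p%:R ^ mn.2].

(* The (p ^ k)-th root is unique when C has characteristic p. *)
Definition Frob (n : int) (z : C) : C :=
  match n with
  | Posz k => z ^+ (p ^ k)
  | Negz k => xget 0 [set y : C | y ^+ (p ^ k.+1) = z]
  end.

Definition zpow (z : C) (e : rat) : C :=
  Frob (expE_repr e).2 z ^+ (expE_repr e).1.

(* A series sum_(e in E) a_e z^e is given by its coefficients a : rat -> C,
   which must vanish outside E. *)
Definition entire (a : rat -> C) : Prop :=
  (forall e, a e != 0 -> expE e) /\
  (forall z : C, null_family (fun e => a e * zpow z e)).

Definition seval (a : rat -> C) (z : C) : C :=
  tsum (fun e => a e * zpow z e).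

Definition smul (a b : rat -> C) : rat -> C :=
  fun e => tsum (fun d => a d * b (e - d)).

Definition sone : rat -> C := fun e => (e == 0)%:R.

Definition spow_nat (b : rat -> C) (m : nat) : rat -> C :=
  iter m (smul b) sone.

(* g^(p^n) = sum_e b_e^(p^n) z^(e p^n) *)
Definition sFrob (n : int) (b : rat -> C) : rat -> C :=
  fun e => Frob n (b (e / p%:R ^ n)).

Definition spow (b : rat -> C) (d : rat) : rat -> C :=
  sFrob (expE_repr d).2 (spow_nat b (expE_repr d).1).

Definition scomp (a b : rat -> C) : rat -> C :=
  fun e => tsum (fun d => a d * spow b d e).

Lemma entire_is_sum a z : entire a ->
  is_sum (fun e => a e * zpow z e) (seval a z).
Proof.
by move=> [_ /(_ z)/null_family_is_sum[s hs]]; rewrite /seval (tsumP hs).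
Qed.

Lemma entire0 : entire (fun=> 0).
Proof.
split=> [e /eqP//|z r r0]; apply: (sub_finite_set _ (@finite_set0 rat)) => e /=.
by rewrite mul0r absv0 ltNge (ltW r0).
Qed.

Lemma entireB a b : entire a -> entire b -> entire (fun e => a e - b e).
Proof.
move=> [Ea ca] [Eb cb]; split=> [e ab0|z r r0].
  have [a0|/Ea//] := eqVneq (a e) 0; apply: Eb.
  by apply: contraNneq ab0 => b0; rewrite a0 b0 subrr.
apply: (@sub_finite_set _ _ ([set e | r < absv (a e * zpow z e)] `|`
  [set e | r < absv (b e * zpow z e)])); last by rewrite finite_setU; split; [exact: ca|exact: cb].
move=> e /=; rewrite mulrBl => /lt_le_trans /(_ (absvB _ _)).
by rewrite lt_max => /orP.
Qed.

Lemma sevalB a b z : entire a -> entire b ->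
  seval (fun e => a e - b e) z = seval a z - seval b z.
Proof.
move=> ea eb; apply: tsumP; have := is_sumB (entire_is_sum z ea) (entire_is_sum z eb).
by congr is_sum; apply/funext => e; rewrite mulrBl.
Qed.

Lemma seval0 z : seval (fun=> 0) z = 0.
Proof.
by apply: tsumP => e e0; exists fset0 => B _; rewrite big1 ?subrr ?absv0// => i _; rewrite mul0r.
Qed.

Record perfSeries := PerfSeries {
  coef :> rat -> C;
  coef_entire : `[< entire coef >]
}.

HB.instance Definition _ := [isSub for coef].
HB.instance Definition _ := [Choice of perfSeries by <:].

Lemma entireP (f : perfSeries) : entire f.
Proof. exact/asboolP/coef_entire. Qed.

Definition mkSeries a (ha : entire a) : perfSeries := PerfSeries (asboolT ha).

Lemma entireN a : entire a -> entire (fun e => - a e).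
Proof.
move=> /(entireB entire0); congr entire; apply/funext => e; exact: sub0r.
Qed.

Lemma entireD a b : entire a -> entire b -> entire (fun e => a e + b e).
Proof.
move=> ea /entireN/(entireB ea); congr entire; apply/funext => e.
by rewrite opprK.
Qed.

Definition pzero := mkSeries entire0.
Definition popp (f : perfSeries) := mkSeries (entireN (entireP f)).
Definition padd (f g : perfSeries) := mkSeries (entireD (entireP f) (entireP g)).

Lemma perfSeries_eqP (f g : perfSeries) : coef f =1 coef g -> f = g.
Proof. by move=> fg; apply/val_inj/funext. Qed.

Lemma paddA : associative padd.
Proof. by move=> f g h; apply: perfSeries_eqP => e; exact: addrA. Qed.
Lemma paddC : commutative padd.
Proof. by move=> f g; apply: perfSeries_eqP => e; exact: addrC. Qed.
Lemma padd0 : left_id pzero padd.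
Proof. by move=> f; apply: perfSeries_eqP => e; exact: add0r. Qed.
Lemma paddN : left_inverse pzero popp padd.
Proof. by move=> f; apply: perfSeries_eqP => e; exact: addNr. Qed.

HB.instance Definition _ :=
  GRing.isZmodule.Build perfSeries paddA paddC padd0 paddN.

Definition disk (r : R) : set C := [set x | absv x <= r].

Definition Pbase (r s : R) : set perfSeries :=
  [set f : perfSeries | seval f @` disk r `<=` disk s].

Definition Pnbhs0 : set_system perfSeries :=
  smallest Filter [set V | exists r s : R, [/\ 0 < r, 0 < s & V = Pbase r s]].

(* The uniform structure of the additive group with neighborhood filter
   Pnbhs0 at 0; the induced topology has the neighborhoods f + V of f. *)
Definition Pentourage : set_system (perfSeries * perfSeries) :=
  filter_from Pnbhs0 (fun V => [set fg | V (fg.2 - fg.1)]).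

Lemma Pbase0 r s : 0 < s -> Pbase r s 0.
Proof. by move=> s0 _ [z _ <-]; rewrite /disk/= seval0 absv0 ltW. Qed.

Lemma PbaseB r s f g : Pbase r s f -> Pbase r s g -> Pbase r s (f - g).
Proof.
move=> hf hg _ [z zr <-]; rewrite /disk/=.
have -> : seval (f - g : perfSeries) z = seval f z - seval g z.
  exact: (sevalB z (entireP f) (entireP g)).
rewrite (le_trans (absvB _ _))// ge_max; apply/andP; split.
  by apply: hf; exists z.
by apply: hg; exists z.
Qed.

Global Instance Pnbhs0_filter : Filter Pnbhs0.
Proof. exact: smallest_filter_filter. Qed.

Lemma Pnbhs0P V :
  Pnbhs0 V <-> exists r s : R, [/\ 0 < r, 0 < s & Pbase r s `<=` V].
Proof.
split; last first.
  move=> [r [s [r0 s0]]] rsV; apply: (@filterS _ Pnbhs0 _ _ _ rsV).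
  by move=> F [_]; apply; exists r, s.
move: V; apply: smallest_sub; last first.
  by move=> V [r [s [r0 s0 ->]]]; exists r, s; split.
split; first by exists 1, 1.
- move=> U V [r [s [r0 s0 rsU]]] [r' [s' [r'0 s'0 rsV]]].
  exists (Num.max r r'), (Num.min s s'); split.
  + by rewrite lt_max r0.
  + by rewrite lt_min s0.
  + move=> f hf; split; [apply: rsU|apply: rsV] => _ [z zr <-].
    * have : disk (Num.min s s') (seval f z).
        by apply: hf; exists z => //; rewrite /disk/= le_max zr.
      by rewrite /disk/= le_min => /andP[].
    * have : disk (Num.min s s') (seval f z).
        by apply: hf; exists z => //; rewrite /disk/= le_max zr orbT.
      by rewrite /disk/= le_min => /andP[].
- by move=> U V UV [r [s [r0 s0 h]]]; exists r, s; split=> //; exact: subset_trans UV.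
Qed.

Lemma Pentourage_filter : Filter Pentourage.
Proof.
apply: filter_from_filter; first by exists setT; exact: (@filterT _ Pnbhs0).
by move=> U V nU nV; exists (U `&` V); [exact: (@filterI _ Pnbhs0)|].
Qed.

Lemma Pentourage_diagonal A : Pentourage A -> diagonal `<=` A.
Proof.
move=> [V /Pnbhs0P[r [s [r0 s0 rsV]]] VA] [f g] /= fg; apply: VA => /=.
by rewrite -[g]fg/= subrr; apply: rsV; exact: Pbase0.
Qed.

Lemma Pentourage_inv A : Pentourage A -> Pentourage (A^-1)%relation.
Proof.
move=> [V /Pnbhs0P[r [s [r0 s0 rsV]]] VA].
exists (Pbase r s); first by apply/Pnbhs0P; exists r, s; split.
move=> [f g] /= hfg; apply: VA => /=; apply: rsV.
by rewrite -opprB -sub0r; apply: PbaseB => //; exact: Pbase0.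
Qed.

Lemma Pentourage_split A : Pentourage A ->
  exists2 B, Pentourage B & (B \; B `<=` A)%relation.
Proof.
move=> [V /Pnbhs0P[r [s [r0 s0 rsV]]] VA].
exists [set fg | Pbase r s (fg.2 - fg.1)].
  by exists (Pbase r s) => //; apply/Pnbhs0P; exists r, s; split.
move=> [f g] /= [h /= fh hg]; apply: VA => /=; apply: rsV.
rewrite -(subrK h g) -addrA -[h - f]opprK; apply: PbaseB => //.
by rewrite -sub0r; apply: PbaseB => //; exact: Pbase0.
Qed.

HB.instance Definition _ := isUniform.Build perfSeries
  Pentourage_filter Pentourage_diagonal Pentourage_inv Pentourage_split.

Lemma nbhs_perfSeriesE (f : perfSeries) (A : set perfSeries) :
  nbhs f A <-> Pnbhs0 [set g | A (f + g)].
Proof.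
rewrite -nbhs_entourageE; split.
  move=> [B [V nV VB] BA]; apply: (@filterS _ Pnbhs0 _ _ _ _ nV) => g Vg; apply: BA.
  by rewrite /xsection/= inE; apply: VB; rewrite /= addrC addKr.
move=> nA; exists [set fg | A (f + (fg.2 - fg.1))].
  by exists [set g | A (f + g)].
by move=> g /xsectionP/=; rewrite addrC subrK.
Qed.

Definition Fseries (q : nat) : set perfSeries :=
  [set f | forall e, f e != 0 -> exists n : int, e = q%:R ^ n].

End Series.

(* The subset A of T, with the addition of T, the multiplication mul and the
   induced uniform structure, is a complete topological (unital) ring. *)
Record complete_topological_ring (T : PreUniformZmodule.type) (A : set T)
    (mul : T -> T -> T) : Prop := {
  ctr_zero : A 0;
  ctr_sub : forall x y, A x -> A y -> A (x - y);
  ctr_mul : forall x y, A x -> A y -> A (mul x y);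
  ctr_mulA : forall x y z, A x -> A y -> A z ->
    mul x (mul y z) = mul (mul x y) z;
  ctr_mulDl : forall x y z, A x -> A y -> A z ->
    mul (x + y) z = mul x z + mul y z;
  ctr_mulDr : forall x y z, A x -> A y -> A z ->
    mul x (y + z) = mul x y + mul x z;
  ctr_unit : exists one, A one /\
    forall x, A x -> mul one x = x /\ mul x one = x;
  ctr_add_continuous :
    {within A `*` A, continuous (fun xy : T * T => xy.1 + xy.2)};
  ctr_opp_continuous : {within A, continuous (fun x : T => - x)};
  ctr_mul_continuous :
    {within A `*` A, continuous (fun xy : T * T => mul xy.1 xy.2)};
  ctr_complete : forall G : set_system T, ProperFilter G -> G A ->
    cauchy G -> exists2 l : T, A l & G --> l
}.

(* Main.v *)
(* A series of P is determined by its values, and its topology can be read off its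
   coefficients: if |f| <= s on the disk of radius |c|, then |a_e c^e| <= s for every e.
   Averaging over roots of unity of order p^M - 1 isolates one coefficient of a finite
   partial sum, and p^M - 1 = -1 in C has absolute value 1.  The algebraic identities of
   both rings therefore follow from (fg)(z) = f(z)g(z) and (f o g)(z) = f(g(z)), the
   latter obtained by exchanging an unconditional double sum.  Continuity is proved
   pointwise, using that f is uniformly continuous on bounded disks, and Cauchy filters
   converge coefficientwise.  The trivial absolute value needs no separate treatment,
   because every disk is contained in one of radius |c| for some c in C. *)
Require Import Defs.
From HB Require Import structures.
From mathcomp Require Import all_boot all_order all_algebra.
From mathcomp Require Import all_field.
From mathcomp Require Import finmap.
From mathcomp Require Import all_classical all_reals all_analysis.
From mathcomp Require Import ring lra zify.

Set Implicit Arguments.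
Unset Strict Implicit.
Unset Printing Implicit Defensive.

Import Order.TTheory GRing.Theory Num.Theory.
Local Open Scope classical_set_scope.
Local Open Scope ring_scope.

(** * Unconditional sums in the ultrametric field and their exchange *)

Section Sums.
Variables (R : realType) (C : completeNAField R).
Implicit Types (I J : choiceType) (x y z : C) (r s : R).

Lemma absv_le_gt0_eq0 x : (forall eps : R, 0 < eps -> absv x <= eps) -> x = 0.
Proof.
move=> h; apply/absv_eq0/eqP; rewrite eq_le absv_ge0 andbT.
by apply/ler_addgt0Pl => e e0; rewrite addr0 h.
Qed.

Lemma absvX x n : absv (x ^+ n) = absv x ^+ n.
Proof.
by elim: n => [|n IH]; rewrite ?expr0 ?absv1// !exprS absvM IH.
Qed.

Lemma absvD_le x y r : absv x <= r -> absv y <= r -> absv (x + y) <= r.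
Proof. by move=> xr yr; rewrite (le_trans (absvD x y))// ge_max xr yr. Qed.

Lemma absvB_le x y r : absv x <= r -> absv y <= r -> absv (x - y) <= r.
Proof. by move=> xr yr; apply: absvD_le; rewrite ?absvN. Qed.

(** Lets real radii be replaced by radii [absv c]. If some [absv x > 1], Bernoulli's inequality
    makes its powers unbounded; otherwise every absolute value is at most 1 and [c = 1] serves,
    which covers the trivial absolute value. *)
Lemma disk_cover r : exists2 c : C, c != 0 & disk (C := C) r `<=` disk (absv c).
Proof.
have [[x x1]|h] := pselect (exists x : C, 1 < absv x); last first.
  exists 1; rewrite ?oner_eq0// => x _; rewrite /disk/= absv1 leNgt.
  by apply/negP => x1; apply: h; exists x.
have x0 : x != 0.
  by apply: contraTneq x1 => ->; rewrite absv0 -leNgt ler01.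
exists (x ^+ (Num.truncn (r / (absv x - 1))).+1); first by rewrite expf_neq0.
move=> y /= yr; rewrite /disk/= absvX (le_trans yr)//.
have d0 : 0 < absv x - 1 by rewrite subr_gt0.
have := truncnS_gt (r / (absv x - 1)); set n := _.+1.
rewrite ltr_pdivrMr// => /ltW /le_trans; apply.
have : 1 + n%:R * (absv x - 1) <= absv x ^+ n; last by apply: le_trans; lra.
elim: n => [|n IH]; first by rewrite mul0r addr0 expr0.
rewrite exprS -natr1; have n0 : 0 <= n%:R :> R by [].
move: (absv x) x1 d0 IH => t t1 d0 IH.
have := ler_wpM2l (ltW (lt_trans ltr01 t1)) IH.
have : 0 <= n%:R * (t - 1) * (t - 1) by rewrite !mulr_ge0// ltW.
by rewrite mulrDr; nra.
Qed.

Lemma null_sum I (u : I -> C) : null_family u -> is_sum u (tsum u).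
Proof. by move=> /null_family_is_sum[s us]; rewrite (tsumP us). Qed.

(** By the ultrametric inequality, a tail all of whose terms are at most [r] has sum at most [r],
    however many terms it has. *)
Lemma is_sum_approx I (u : I -> C) x (A : {fset I}) r : 0 <= r -> is_sum u x ->
  (forall i, i \notin A -> absv (u i) <= r) ->
  absv (x - \sum_(i <- A) u i) <= r.
Proof.
move=> r0 ux ur; apply/ler_addgt0Pl => e e0; have [B hB] := ux e e0.
have := hB _ (fsubsetUr A B); set D := (A `|` B)%fset => hD.
have le : absv (\sum_(i <- D) u i - \sum_(i <- A) u i) <= r.
  rewrite (big_fsetID _ (mem A))/=.
  have -> : [fset x in D | x \in A]%fset = A.
    by apply/fsetP => i; rewrite !inE/=; case: (i \in A); rewrite ?andbF ?andbT.
  rewrite addrC addrK; apply: absv_sum_le => // i.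
  by rewrite !inE/= => /andP[_ iA] _; exact: ur.
have -> : x - \sum_(i <- A) u i =
  (\sum_(i <- D) u i - \sum_(i <- A) u i) - (\sum_(i <- D) u i - x) by ring.
apply: absvB_le; first by rewrite (le_trans le)// lerDr ltW.
by rewrite (le_trans (ltW hD))// lerDl.
Qed.

Lemma is_sum_le I (u : I -> C) x r : 0 <= r -> is_sum u x ->
  (forall i, absv (u i) <= r) -> absv x <= r.
Proof.
move=> r0 ux ur; have := @is_sum_approx I u x fset0 r r0 ux.
by rewrite big_nil subr0; apply => i _.
Qed.

Lemma tsum_le I (u : I -> C) r : 0 <= r -> null_family u ->
  (forall i, absv (u i) <= r) -> absv (tsum u) <= r.
Proof. by move=> r0 nu; apply: is_sum_le r0 (null_sum nu). Qed.

Lemma tsum_neq0 I (u : I -> C) : tsum u != 0 -> exists i, u i != 0.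
Proof.
apply: contraPP => /forallNP u0; apply/negP; rewrite negbK; apply/eqP.
apply: tsumP => e e0; exists fset0 => B _; rewrite subr0 big1 ?absv0// => i _.
by apply/eqP/negPn/negP; exact: u0.
Qed.

Lemma is_sum_fin I (u : I -> C) (A : {fset I}) :
  (forall i, i \notin A -> u i = 0) -> is_sum u (\sum_(i <- A) u i).
Proof.
move=> u0 e e0; exists A => B AB; rewrite (big_fsetID _ (mem A))/=.
have -> : [fset x in B | x \in A]%fset = A.
  by apply/fsetP => i; rewrite !inE/= andbC; case: (boolP (i \in A)) => //= /(fsubsetP AB).
rewrite addrC addrK big_seq big1 ?absv0// => i.
by rewrite !inE/= => /andP[_ /u0].
Qed.

Lemma null_family_fsetP I (u : I -> C) r : null_family u -> 0 < r ->
  exists A : {fset I}, forall i, i \notin A -> absv (u i) <= r.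
Proof.
move=> nu r0; exists (fset_set [set i | r < absv (u i)]) => i.
rewrite in_fset_set; last exact: nu.
by move=> ir; rewrite leNgt; apply: contra ir => ir; exact: mem_set.
Qed.

Lemma fsetP_null_family I (u : I -> C) :
  (forall r, 0 < r -> exists A : {fset I}, forall i, i \notin A -> absv (u i) <= r) ->
  null_family u.
Proof.
move=> h r r0; have [A hA] := h r r0.
apply: (sub_finite_set _ (finite_fset A)) => i /=; rewrite ltNge.
by apply: contraR => /hA.
Qed.

Lemma null_family_bound I (u : I -> C) : null_family u ->
  exists2 M, 0 < M & forall i, absv (u i) <= M.
Proof.
move=> /null_family_fsetP/(_ ltr01)[A hA].
have S0 : 0 <= \sum_(i <- A) absv (u i) by apply: sumr_ge0 => i _; exact: absv_ge0.
exists (1 + \sum_(i <- A) absv (u i)) => [|i]; first by rewrite ltr_pwDl.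
have [iA|/hA ui] := boolP (i \in A); last by rewrite (le_trans ui)// lerDl.
rewrite (big_fsetD1 i)//= addrCA lerDl addr_ge0// sumr_ge0// => j _.
exact: absv_ge0.
Qed.

Lemma null_family_le I (u w : I -> C) :
  null_family u -> (forall i, absv (w i) <= absv (u i)) -> null_family w.
Proof.
move=> nu wu r r0; apply: (sub_finite_set _ (nu r r0)) => i /= /lt_le_trans.
exact.
Qed.

Lemma null_family_inj I J (h : J -> I) (u : I -> C) :
  injective h -> null_family u -> null_family (u \o h).
Proof.
move=> hi nu r r0; apply: (@finite_preimage _ _ [set i | r < absv (u i)] h).
  by move=> x y _ _; exact: hi.
exact: nu.
Qed.

Lemma is_sum_reindex I J (h : J -> I) (h' : I -> J) (u : I -> C) x :
  cancel h h' -> cancel h' h -> is_sum u x -> is_sum (u \o h) x.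
Proof.
move=> hK h'K ux e e0; have [A hA] := ux e e0.
exists [fset h' i | i in A]%fset => B AB.
have := hA [fset h j | j in B]%fset; rewrite big_imfset/=; last first.
  by move=> i j _ _; exact: (can_inj hK).
apply; apply/fsubsetP => i iA; apply/imfsetP; exists (h' i) => //=.
by apply: (fsubsetP AB); apply/imfsetP; exists i.
Qed.

(** Continuity at 0 only; for additive maps this already gives uniform continuity. *)
Definition absv_continuous (phi : C -> C) : Prop := forall e : R, 0 < e ->
  exists2 d : R, 0 < d & forall x, absv x <= d -> absv (phi x) <= e.

Lemma is_sum_morph I (phi : C -> C) (u : I -> C) x : additive phi ->
  absv_continuous phi -> is_sum u x -> is_sum (phi \o u) (phi x).
Proof.
move=> phiB phic ux e e0.
have phi0 : phi 0 = 0 by have := phiB 0 0; rewrite !subrr.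
have phiD y z : phi (y + z) = phi y + phi z.
  by rewrite -[z in LHS]opprK phiB -[- z]sub0r phiB phi0 sub0r opprK.
have [d d0 hd] := phic (e / 2) (divr_gt0 e0 (ltr0Sn _ 1)).
have [A hA] := ux d d0; exists A => B AB.
rewrite -(big_morph phi phiD phi0) -phiB (@le_lt_trans _ _ (e / 2))//; last lra.
by apply: hd; exact/ltW/hA.
Qed.

Lemma null_family_morph I (phi : C -> C) (u : I -> C) :
  absv_continuous phi -> null_family u -> null_family (phi \o u).
Proof.
move=> phic nu r r0; have [d d0 hd] := phic r r0.
apply: (sub_finite_set _ (nu d d0)) => i /=; rewrite !ltNge.
by apply: contra; exact: hd.
Qed.

Lemma absv_continuousM y : absv_continuous ( *%R y).
Proof.
move=> e e0; have y0 := absv_ge0 y; exists (e / (absv y + 1)).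
  by rewrite divr_gt0// ltr_wpDl.
move=> x; rewrite absvM ler_pdivlMr ?ltr_wpDl// => /(le_trans _); apply.
by rewrite mulrC ler_wpM2l ?absv_ge0// lerDl.
Qed.

Lemma is_sumZ I y (u : I -> C) x : is_sum u x -> is_sum (fun i => y * u i) (y * x).
Proof. apply: is_sum_morph; [exact: mulrBr|exact: absv_continuousM]. Qed.

Lemma null_familyZ I y (u : I -> C) : null_family u -> null_family (fun i => y * u i).
Proof. exact/null_family_morph/absv_continuousM. Qed.

Lemma is_sumD I (u w : I -> C) x y : is_sum u x -> is_sum w y ->
  is_sum (fun i => u i + w i) (x + y).
Proof.
move=> ux /(is_sumZ (-1)) /(is_sumB ux); rewrite mulN1r opprK.
by congr is_sum; apply/funext => i; rewrite mulN1r opprK.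
Qed.

Section Double.
Variables (I J : choiceType) (u : I -> J -> C).
(** The double family tends to 0 along finite rectangles. This one condition makes rows, columns and
    the row sums null. *)
Hypothesis nu : forall r, 0 < r -> exists (A : {fset I}) (B : {fset J}),
  forall i j, ~~ ((i \in A) && (j \in B)) -> absv (u i j) <= r.

Lemma double_null_row i : null_family (u i).
Proof.
apply: fsetP_null_family => r /nu[A [B hAB]]; exists B => j jB.
by apply: hAB; rewrite (negPf jB) andbF.
Qed.

Lemma double_null_col j : null_family (u ^~ j).
Proof.
apply: fsetP_null_family => r /nu[A [B hAB]]; exists A => i iA.
by apply: hAB; rewrite (negPf iA).
Qed.

Lemma double_null_tsum : null_family (fun i => tsum (u i)).
Proof.
apply: fsetP_null_family => r r0; have [A [B hAB]] := nu r0; exists A => i iA.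
apply: tsum_le (ltW r0) (double_null_row i) _ => j.
by apply: hAB; rewrite (negPf iA).
Qed.

Lemma double_tsum_approx (A : {fset I}) (B : {fset J}) r : 0 < r ->
  (forall i j, ~~ ((i \in A) && (j \in B)) -> absv (u i j) <= r) ->
  absv (tsum (fun i => tsum (u i)) - \sum_(i <- A) \sum_(j <- B) u i j) <= r.
Proof.
move=> r0 hAB.
have r0' := ltW r0.
have row i : absv (tsum (u i) - \sum_(j <- B) u i j) <= r.
  apply: is_sum_approx => //; first exact/null_sum/double_null_row.
  by move=> j jB; apply: hAB; rewrite (negPf jB) andbF.
have -> : tsum (fun i => tsum (u i)) - \sum_(i <- A) \sum_(j <- B) u i j =
  (tsum (fun i => tsum (u i)) - \sum_(i <- A) tsum (u i)) +
  \sum_(i <- A) (tsum (u i) - \sum_(j <- B) u i j) by rewrite sumrB; ring.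
apply: absvD_le; last by apply: absv_sum_le => // i _ _; exact: row.
apply: is_sum_approx => //; first exact/null_sum/double_null_tsum.
move=> i iA; apply: tsum_le => //; first exact: double_null_row.
by move=> j; apply: hAB; rewrite (negPf iA).
Qed.

End Double.

(** Both iterated sums lie within [e] of the same finite sum over the rectangle [A] times [B], for
    every [e > 0]. *)
Lemma tsum_exchange I J (u : I -> J -> C) :
  (forall r, 0 < r -> exists (A : {fset I}) (B : {fset J}),
    forall i j, ~~ ((i \in A) && (j \in B)) -> absv (u i j) <= r) ->
  tsum (fun i => tsum (u i)) = tsum (fun j => tsum (u ^~ j)).
Proof.
move=> nu; apply/eqP; rewrite -subr_eq0; apply/eqP/absv_le_gt0_eq0 => e e0.
have nu' r : 0 < r -> exists (B : {fset J}) (A : {fset I}),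
    forall j i, ~~ ((j \in B) && (i \in A)) -> absv (u i j) <= r.
  by move=> /nu[A [B hAB]]; exists B, A => j i; rewrite andbC; exact: hAB.
have [A [B hAB]] := nu _ e0.
have le1 := double_tsum_approx nu e0 hAB.
have le2 : absv (tsum (fun j => tsum (u ^~ j)) -
    \sum_(j <- B) \sum_(i <- A) u i j) <= e.
  by apply: (double_tsum_approx nu' e0) => j i; rewrite andbC; exact: hAB.
rewrite exchange_big/= in le2; rewrite -(subrKA (\sum_(i <- A) \sum_(j <- B) u i j)).
by apply: absvD_le => //; rewrite -absvN opprB.
Qed.

End Sums.

(** * Frobenius maps and fractional powers in characteristic p *)

Section Powers.
Variables (R : realType) (C : completeNAField R) (p : nat).
Hypotheses (p_prime : prime p) (pcharC : p \in [pchar C]).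
Implicit Types (x y z : C) (d e : rat) (n : int) (k m : nat).

Let pX_gt0 k : (0 < p ^ k)%N. Proof. by rewrite expn_gt0 prime_gt0. Qed.
Let pr0 : p%:R != 0 :> rat. Proof. by rewrite pnatr_eq0 -lt0n prime_gt0. Qed.

Let pchar_natX k : [pchar C].-nat (p ^ k)%N.
Proof. by rewrite pnatX pnatE ?pcharC. Qed.

Lemma exprpXB k : additive (fun x : C => x ^+ (p ^ k)).
Proof.
move=> x y; have := exprDn_pchar (x - y) y (pchar_natX k).
by rewrite subrK => ->; rewrite addrK.
Qed.

(** The main tool for fractional powers: an identity between p-power roots may be checked after
    raising both sides to the power [p ^ k]. *)
Lemma exprpX_inj k : injective (fun x : C => x ^+ (p ^ k)).
Proof.
move=> x y /eqP; rewrite -subr_eq0 -exprpXB expf_eq0 pX_gt0 subr_eq0.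
by move=> /eqP.
Qed.

(** Clearing the p-power denominator replaces an exponent in E by a natural number, so that later
    arguments avoid negative powers of p. *)
Lemma expE_nat e : expE p e -> exists k m, e * p%:R ^+ k = m%:R.
Proof.
move=> [m [[j|j] ->]].
  by exists 0%N, (m * p ^ j)%N; rewrite expr0 mulr1 natrM natrX.
by exists j.+1, m; rewrite /exprz mulfVK// expf_neq0.
Qed.

Lemma nat_expE e k m : e * p%:R ^+ k = m%:R -> expE p e.
Proof.
by move=> h; exists m, (- k%:Z); rewrite -h -exprnN mulfK// expf_neq0.
Qed.

Lemma natpX_le e k l m : e * p%:R ^+ k = m%:R -> (k <= l)%N ->
  e * p%:R ^+ l = (m * p ^ (l - k))%:R.
Proof. by move=> h kl; rewrite natrM -h natrX -mulrA -exprD subnKC. Qed.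

Lemma expE_natU d e : expE p d -> expE p e -> exists k m m',
  d * p%:R ^+ k = m%:R /\ e * p%:R ^+ k = m'%:R.
Proof.
move=> /expE_nat[k [m hd]] /expE_nat[k' [m' he]].
exists (maxn k k'); do 2 eexists; split.
- exact: natpX_le hd (leq_maxl _ _).
- exact: natpX_le he (leq_maxr _ _).
Qed.

Lemma expED d e : expE p d -> expE p e -> expE p (d + e).
Proof.
move=> hd he; have [k [m [m' [h1 h2]]]] := expE_natU hd he.
by apply: (@nat_expE _ k (m + m')%N); rewrite mulrDl h1 h2 natrD.
Qed.

Lemma expEM e n : expE p e -> expE p (e * p%:R ^ n).
Proof. by move=> [m [j ->]]; exists m, (j + n); rewrite -mulrA expfzDr. Qed.

Lemma expE_pX n : expE p (p%:R ^ n).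
Proof. by exists 1%N, n; rewrite mul1r. Qed.

Lemma expE0 : expE p 0.
Proof. by exists 0%N, 0; rewrite mul0r. Qed.

Lemma exists_root k z : exists y, y ^+ (p ^ k) = z.
Proof.
have [|y] := @solve_monicpoly C (p ^ k)%N (fun i => if i == 0%N then z else 0).
  exact: pX_gt0.
case: (p ^ k)%N (pX_gt0 k) => // l _ yE; exists y; rewrite yE.
by rewrite big_ord_recl/= mulr1 big1 ?addr0// => i _; rewrite mul0r.
Qed.

(** Characterizes [Frob p n z] without regard to the sign of [n]; by injectivity of the [p ^ k]-th
    power it determines the value. *)
Lemma FrobE n k m z : p%:R ^ n * p%:R ^+ k = m%:R :> rat ->
  Frob p n z ^+ (p ^ k) = z ^+ m.
Proof.
case: n => j /=.
  rewrite -exprD -natrX => /eqP; rewrite eqr_nat => /eqP <-.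
  by rewrite -exprM expnD.
(* The default value of [xget] is excluded because C is algebraically closed and so contains the
   root. *)
case: xgetP => [y _ <-|/(_ _)]; last by have [y hy] := exists_root j.+1 z => /(_ y).
move=> h; have : (p ^ k)%N = (m * p ^ j.+1)%N.
  apply/eqP; rewrite -(eqr_nat rat) natrM -h !natrX /exprz mulrAC mulVf ?mul1r//.
  by rewrite expf_neq0.
by move=> ->; rewrite -exprM mulnC.
Qed.

Lemma expE_pnat n : exists k m, p%:R ^ n * p%:R ^+ k = m%:R :> rat.
Proof. exact/expE_nat/expE_pX. Qed.

Lemma FrobB n : additive (@Frob R C p n).
Proof.
move=> x y; have [k [m h]] := expE_pnat n; apply: (@exprpX_inj k) => /=.
rewrite exprpXB !(FrobE _ h).
case: n h => j h.
  have -> : m = (p ^ (j + k))%N.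
    by apply/eqP; rewrite -(eqr_nat rat) -h natrX exprD.
  exact: exprpXB.
have := h; rewrite /exprz => h'.
(* For negative [n], [m] divides [p ^ k] and is therefore itself a power of p, so that raising to
   the power [m] is additive. *)
have [l ->] : exists l, m = (p ^ l)%N.
  have : (m %| p ^ k)%N.
    apply/dvdnP; exists (p ^ j.+1)%N; apply/eqP.
    rewrite -(eqr_nat rat) natrM -h' !natrX mulrA mulfV ?mul1r//.
    by rewrite expf_neq0.
  by move=> /(dvdn_pfactor _ _ p_prime)[l _ ->]; exists l.
exact: exprpXB.
Qed.

Lemma FrobM n : {morph (@Frob R C p n) : x y / x * y}.
Proof.
move=> x y; have [k [m h]] := expE_pnat n; apply: (@exprpX_inj k) => /=.
by rewrite exprMn !(FrobE _ h) exprMn.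
Qed.

Lemma Frob1 n : Frob p n (1 : C) = 1.
Proof.
have [k [m h]] := expE_pnat n; apply: (@exprpX_inj k) => /=.
by rewrite (FrobE _ h) !expr1n.
Qed.

Lemma FrobX n m : {morph (@Frob R C p n) : x / x ^+ m}.
Proof.
move=> x; elim: m => [|m IH]; first by rewrite !expr0 Frob1.
by rewrite !exprS FrobM IH.
Qed.

Lemma Frob_eq0 n z : (Frob p n z == 0) = (z == 0).
Proof.
have [k [m h]] := expE_pnat n.
have m0 : (0 < m)%N.
  by rewrite lt0n -(eqr_nat rat) -h mulf_neq0 ?expf_neq0// expfz_neq0.
have := congr1 (fun x => x == 0) (FrobE z h).
by rewrite /= !expf_eq0 pX_gt0 m0.
Qed.

Lemma Frob_continuous n : absv_continuous (@Frob R C p n).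
Proof.
move=> e e0; have [k [m h]] := expE_pnat n.
have m0 : (0 < m)%N.
  by rewrite lt0n -(eqr_nat rat) -h mulf_neq0 ?expf_neq0// expfz_neq0.
(* The [p ^ k]-th power of the absolute value of [Frob p n x] is [absv x ^+ m], which is at most
   [absv x] once [absv x <= 1], since [m > 0]. *)
exists (Num.min 1 (e ^+ (p ^ k))); first by rewrite lt_min ltr01 exprn_gt0.
move=> x; rewrite le_min => /andP[x1 xe].
rewrite -(@ler_pXn2r _ (p ^ k)) ?nnegrE ?absv_ge0 ?(ltW e0)//.
rewrite -absvX (FrobE _ h) absvX (le_trans _ xe)//.
by case: m m0 {h} => // m _; rewrite exprS ler_piMr ?absv_ge0// exprn_ile1 ?absv_ge0.
Qed.

(** Shows that [zpow] does not depend on the representation of [e] chosen by [expE_repr]: any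
    equation [e * p ^ k = m] determines its value. *)
Lemma zpowE e k m z : e * p%:R ^+ k = m%:R -> zpow p z e ^+ (p ^ k) = z ^+ m.
Proof.
move=> h; rewrite /zpow /expE_repr.
(* The default is again excluded, since [(m, - k)] represents [e]. *)
case: xgetP => [[m' n] _ /= he|/(_ (m, - k%:Z))/=]; last first.
  by case; rewrite -h -exprnN mulfK// expf_neq0.
have [l [i hl]] := expE_pnat n; apply: (@exprpX_inj l) => /=.
rewrite -!exprM mulnA [(_ * p ^ l)%N in LHS]mulnC exprM (FrobE _ hl) -exprM.
congr (_ ^+ _); apply/eqP; rewrite -(eqr_nat rat) !natrM -hl -h he !natrX.
by apply/eqP; ring.
Qed.

Lemma zpowD d e z : expE p d -> expE p e ->
  zpow p z (d + e) = zpow p z d * zpow p z e.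
Proof.
move=> hd he; have [k [m [m' [h1 h2]]]] := expE_natU hd he.
apply: (@exprpX_inj k) => /=; rewrite exprMn (zpowE _ h1) (zpowE _ h2) -exprD.
by apply: zpowE; rewrite mulrDl h1 h2 natrD.
Qed.

Lemma zpow0 z : zpow p z 0 = 1.
Proof. by have := @zpowE 0 0 0 z (mul0r _). Qed.

Lemma zpow1 z : zpow p z 1 = z.
Proof. by have := @zpowE 1 0 1 z (mul1r _). Qed.

Lemma zpowM e x y : expE p e -> zpow p (x * y) e = zpow p x e * zpow p y e.
Proof.
move=> /expE_nat[k [m h]]; apply: (@exprpX_inj k) => /=.
by rewrite exprMn !(zpowE _ h) exprMn.
Qed.

Lemma zpow1n e : zpow p (1 : C) e = 1.
Proof. by rewrite /zpow Frob1 expr1n. Qed.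

(** Used to turn fractional powers of a root of unity into ordinary ones. *)
Lemma zpow_exprpX e k m z : e * p%:R ^+ k = m%:R -> zpow p (z ^+ (p ^ k)) e = z ^+ m.
Proof.
move=> h; apply: (@exprpX_inj k) => /=.
by rewrite (zpowE _ h) -!exprM mulnC.
Qed.

Lemma zpow_Frob e n z : expE p e -> zpow p z (e * p%:R ^ n) = Frob p n (zpow p z e).
Proof.
move=> /expE_nat[k [m h]]; have [l [i hl]] := expE_pnat n.
apply: (@exprpX_inj (l + k)) => /=; rewrite (@zpowE _ _ (m * i)); last first.
  by rewrite exprD natrM -h -hl; ring.
by rewrite expnD [in RHS]exprM (FrobE _ hl) exprAC (zpowE _ h) -exprM.
Qed.

Lemma zpow_le e x y : expE p e -> absv x <= absv y ->
  absv (zpow p x e) <= absv (zpow p y e).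
Proof.
move=> /expE_nat[k [m h]] xy.
rewrite -(@ler_pXn2r _ (p ^ k)) ?nnegrE ?absv_ge0//.
by rewrite -!absvX !(zpowE _ h) !absvX lerXn2r ?nnegrE ?absv_ge0.
Qed.

Lemma zpow_pX n z : zpow p z (p%:R ^ n) = Frob p n z.
Proof. by rewrite -[X in zpow p z X]mul1r zpow_Frob ?zpow1//; exists 1%N, 0; rewrite mulr1. Qed.

Lemma zpow_repr z e : zpow p z e = Frob p (expE_repr p e).2 (z ^+ (expE_repr p e).1).
Proof. by rewrite FrobX. Qed.

Lemma absv_exprB x y m (M : R) : 1 <= M -> absv x <= M -> absv y <= M ->
  absv (x ^+ m - y ^+ m) <= absv (x - y) * M ^+ m.
Proof.
move=> M1 xM yM; have M0 := le_trans ler01 M1.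
have dM0 k : 0 <= absv (x - y) * M ^+ k by rewrite mulr_ge0 ?absv_ge0 ?exprn_ge0.
elim: m => [|m IH]; first by rewrite !expr0 subrr absv0 mulr1 absv_ge0.
have -> : x ^+ m.+1 - y ^+ m.+1 = x * (x ^+ m - y ^+ m) + (x - y) * y ^+ m.
  by rewrite !exprS; ring.
apply: absvD_le; rewrite absvM.
  by rewrite exprS mulrCA ler_pM ?absv_ge0.
rewrite ler_wpM2l ?absv_ge0// absvX exprS (@le_trans _ _ (M ^+ m))//.
  by rewrite lerXn2r ?nnegrE ?absv_ge0.
by rewrite ler_peMl// exprn_ge0.
Qed.

(** The power is [Frob] applied to an ordinary power. As [Frob] is additive, continuity at 0
    suffices, combined with the Lipschitz bound for ordinary powers on a bounded disk. *)
Lemma zpow_unif_continuous (M : R) e (eps : R) : 0 < eps -> exists2 del : R, 0 < del &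
  forall x y, absv x <= M -> absv y <= M -> absv (x - y) <= del ->
    absv (zpow p x e - zpow p y e) <= eps.
Proof.
move=> eps0; have [d d0 hd] := Frob_continuous (expE_repr p e).2 eps0.
set m := (expE_repr p e).1; pose M' := Num.max 1 M.
have M'1 : 1 <= M' by rewrite le_max lexx.
have M'm : 0 < M' ^+ m by rewrite exprn_gt0// (lt_le_trans ltr01).
exists (d / M' ^+ m); first by rewrite divr_gt0.
move=> x y xM yM; rewrite ler_pdivlMr// => xy.
rewrite !zpow_repr -FrobB; apply: hd; apply: le_trans xy.
by apply: absv_exprB => //; rewrite le_max ?xM ?yM orbT.
Qed.

End Powers.

Section Evaluation.
Variables (R : realType) (C : completeNAField R) (p : nat).
Hypotheses (p_prime : prime p) (pcharC : p \in [pchar C]).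
Implicit Types (a b : rat -> C) (x y z : C) (d e : rat) (n : int) (k m : nat).

Let pr0 : p%:R != 0 :> rat. Proof. by rewrite pnatr_eq0 -lt0n prime_gt0. Qed.

(** * Infinite linear combinations of entire series *)

Section LinearCombination.
Variables (a : rat -> C) (h : rat -> rat -> C).
Hypothesis h_entire : forall d, a d != 0 -> entire p (h d).
(** Domination by a null family in [d], uniformly in [e]. The product takes for [h d] the shift of
    [b] by [d], the composition the power of [b] with exponent [d]. *)
Hypothesis h_null : forall z, exists2 v : rat -> C, null_family v &
  forall d e, absv (a d * (h d e * zpow p z e)) <= absv (v d).

(** Outside a finite set [A] of [d] the dominating family is small. For each of the finitely many
    [d] in [A], entireness of [h d] leaves finitely many [e]; [B] is their union. *)
Lemma lincomb_double_null z (r : R) : 0 < r -> exists (A B : {fset rat}),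
  forall d e, ~~ ((d \in A) && (e \in B)) -> absv (a d * (h d e * zpow p z e)) <= r.
Proof.
move=> r0; have [v nv hv] := h_null z.
have [A hA] := null_family_fsetP nv r0.
have /choice[B hB] : forall d, exists B : {fset rat}, forall e, e \notin B ->
    absv (a d * (h d e * zpow p z e)) <= r.
  move=> d; have [a0|/h_entire[_ /(_ z) nh]] := eqVneq (a d) 0.
    by exists fset0 => e _; rewrite a0 mul0r absv0 ltW.
  exact: (null_family_fsetP (null_familyZ (a d) nh) r0).
exists A, (\bigcup_(d <- A) B d)%fset => d e; rewrite negb_and => /orP[dA|eB].
  exact: le_trans (hv d e) (hA d dA).
have [dA|dA] := boolP (d \in A); last exact: le_trans (hv d e) (hA d dA).
apply: hB; apply: contra eB => eB; apply/bigfcupP; exists d => //.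
by rewrite dA.
Qed.

Lemma lincomb_double_null_sym z (r : R) : 0 < r -> exists (B A : {fset rat}),
  forall e d, ~~ ((e \in B) && (d \in A)) -> absv (a d * (h d e * zpow p z e)) <= r.
Proof.
move=> /(lincomb_double_null z)[A [B hAB]]; exists B, A => e d.
by rewrite andbC; exact: hAB.
Qed.

Lemma lincomb_null e : null_family (fun d => a d * h d e).
Proof.
(* At [z = 1] all powers equal 1, so the weighted column is the column of coefficients. *)
have := double_null_col (lincomb_double_null 1) e; congr null_family.
by apply/funext => d; rewrite zpow1n// mulr1.
Qed.

Lemma lincomb_termE z : (fun e => tsum (fun d => a d * h d e) * zpow p z e) =
  (fun e => tsum (fun d => a d * (h d e * zpow p z e))).
Proof.
apply/funext => e; apply/esym/tsumP; rewrite mulrC.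
have := is_sumZ (zpow p z e) (null_sum (lincomb_null e)).
by congr is_sum; apply/funext => d; rewrite mulrC mulrA.
Qed.

Lemma lincomb_entire : entire p (fun e => tsum (fun d => a d * h d e)).
Proof.
split=> [e /tsum_neq0[d]|z].
  by rewrite mulf_eq0 negb_or => /andP[/h_entire[+ _] he]; exact.
by rewrite lincomb_termE; exact: (double_null_tsum (lincomb_double_null_sym z)).
Qed.

Lemma lincomb_seval z : seval p (fun e => tsum (fun d => a d * h d e)) z =
  tsum (fun d => a d * seval p (h d) z).
Proof.
rewrite /seval lincomb_termE -(tsum_exchange (lincomb_double_null z)).
congr tsum; apply/funext => d; have [->|a0] := eqVneq (a d) 0.
  rewrite mul0r; apply: tsumP => eps eps0; exists fset0 => B _.
  by rewrite subr0 big1 ?absv0// => i _; rewrite mul0r.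
by apply: tsumP; apply: is_sumZ; apply: entire_is_sum; exact: h_entire.
Qed.

End LinearCombination.

Lemma entire_bound a z : entire p a ->
  exists2 M : R, 0 < M & forall e, absv (a e * zpow p z e) <= M.
Proof. by move=> [_ /(_ z)/null_family_bound]. Qed.

Lemma shift_termE b d z : entire p b -> expE p d ->
  (fun e => b (e - d) * zpow p z e) =
  (fun e => zpow p z d * (b e * zpow p z e)) \o (fun e => e - d).
Proof.
move=> [Eb _] Ed; apply/funext => e /=.
have [->|/Eb Eed] := eqVneq (b (e - d)) 0; first by rewrite !mul0r mulr0.
by rewrite mulrCA -zpowD// [d + _]addrC subrK.
Qed.

Lemma shift_entire b d : entire p b -> expE p d -> entire p (fun e => b (e - d)).
Proof.
move=> eb Ed; split=> [e /eb.1 Eed|z]; first by rewrite -(subrK d e); exact: expED.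
rewrite shift_termE//; apply: null_family_inj; first exact: addIr.
exact/null_familyZ/eb.2.
Qed.

Lemma shift_seval b d z : entire p b -> expE p d ->
  seval p (fun e => b (e - d)) z = zpow p z d * seval p b z.
Proof.
move=> eb Ed; apply: tsumP; rewrite shift_termE//.
apply: (is_sum_reindex (subrK d) (addrK d)).
exact/is_sumZ/entire_is_sum.
Qed.

(** * Products, powers and Frobenius twists of entire series *)

Section Product.
Variables (a b : rat -> C).
Hypotheses (ea : entire p a) (eb : entire p b).

Let h_entire d : a d != 0 -> entire p (fun e => b (e - d)).
Proof. by move=> /ea.1; exact: shift_entire. Qed.

Let h_null z : exists2 v : rat -> C, null_family v &
  forall d e, absv (a d * (b (e - d) * zpow p z e)) <= absv (v d).
Proof.
have [M M0 hM] := entire_bound z eb.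
have [c c0 Mc] := disk_cover C M.
(* Shifting by [d] pulls out the factor [zpow p z d]; what remains is a term of [b] at [z], bounded
   by [absv c] for every [e]. *)
exists (fun d => c * (a d * zpow p z d)); first exact/null_familyZ/ea.2.
move=> d e; have [->|/ea.1 Ed] := eqVneq (a d) 0; first by rewrite !mul0r mulr0.
have := congr1 (fun f => f e) (shift_termE z eb Ed) => /= ->.
rewrite mulrA absvM mulrC [leRHS]absvM ler_wpM2r ?absv_ge0//.
exact: Mc (hM _).
Qed.

Lemma smul_entire : entire p (smul a b).
Proof. exact: (lincomb_entire h_entire h_null). Qed.

Lemma smul_seval z : seval p (smul a b) z = seval p a z * seval p b z.
Proof.
rewrite [LHS](lincomb_seval h_entire h_null); apply: tsumP.
rewrite mulrC; have := is_sumZ (seval p b z) (entire_is_sum z ea).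
congr is_sum; apply/funext => d; have [->|/ea.1 Ed] := eqVneq (a d) 0.
  by rewrite !mul0r mulr0.
by rewrite shift_seval// mulrC mulrA.
Qed.

End Product.

Definition monomial d : rat -> C := fun e => (e == d)%:R.

Lemma monomial_is_sum d z : is_sum (fun e => monomial d e * zpow p z e) (zpow p z d).
Proof.
have := @is_sum_fin R C _ (fun e => monomial d e * zpow p z e) [fset d]%fset.
rewrite big_seq_fset1 /monomial eqxx mul1r; apply => e.
by rewrite in_fset1 => /negPf h; rewrite h mul0r.
Qed.

Lemma monomial_entire d : expE p d -> entire p (monomial d).
Proof.
move=> Ed; split=> [e|z]; first by rewrite /monomial; case: (eqVneq e d) => [->//|_]; rewrite eqxx.
apply: fsetP_null_family => r r0; exists [fset d]%fset => e.
by rewrite in_fset1 /monomial => /negPf h; rewrite h mul0r absv0 ltW.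
Qed.

Lemma monomial_seval d z : seval p (monomial d) z = zpow p z d.
Proof. exact/tsumP/monomial_is_sum. Qed.

Lemma spow_nat_entire b m : entire p b -> entire p (spow_nat b m).
Proof.
by move=> eb; elim: m => [|m IH]; [exact/monomial_entire/expE0|exact: smul_entire].
Qed.

Lemma spow_nat_seval b m z : entire p b ->
  seval p (spow_nat b m) z = seval p b z ^+ m.
Proof.
move=> eb; elim: m => [|m IH]; first by rewrite [LHS]monomial_seval zpow0.
by rewrite exprS -IH -smul_seval//; exact: spow_nat_entire.
Qed.

(** Puts the terms in the form additive map after old terms after bijective reindexing, so that
    nullness and sums carry over. *)
Lemma sFrob_termE b n z : entire p b ->
  (fun e => sFrob p n b e * zpow p z e) =
  (@Frob R C p n \o (fun e => b e * zpow p z e)) \o (fun e => e / p%:R ^ n).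
Proof.
move=> [Eb _]; apply/funext => e /=; rewrite FrobM// /sFrob.
have [->|/Eb Ee] := eqVneq (b (e / p%:R ^ n)) 0.
  have /eqP -> : Frob p n (0 : C) == 0 by rewrite Frob_eq0.
  by rewrite !mul0r.
by rewrite -zpow_Frob// divfK// expfz_neq0.
Qed.

Lemma sFrob_entire b n : entire p b -> entire p (sFrob p n b).
Proof.
move=> eb; split=> [e|z].
  rewrite /sFrob Frob_eq0// => /eb.1/(expEM p_prime n).
  by rewrite divfK// expfz_neq0.
rewrite sFrob_termE//; apply: null_family_inj.
  by apply: mulIf; rewrite invr_eq0 expfz_neq0.
apply: null_family_morph; first exact: Frob_continuous.
exact: eb.2.
Qed.

Lemma sFrob_seval b n z : entire p b ->
  seval p (sFrob p n b) z = Frob p n (seval p b z).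
Proof.
have pn0 : p%:R ^ n != 0 :> rat by rewrite expfz_neq0.
move=> eb; apply: tsumP; rewrite sFrob_termE//.
apply: (is_sum_reindex (divfK pn0) (mulfK pn0)).
apply: is_sum_morph; [exact: FrobB|exact: Frob_continuous|exact: entire_is_sum].
Qed.

Lemma spow_entire b d : entire p b -> entire p (spow p b d).
Proof. by move=> eb; apply/sFrob_entire/spow_nat_entire. Qed.

Lemma spow_seval b d z : entire p b -> seval p (spow p b d) z = zpow p (seval p b z) d.
Proof.
move=> eb; rewrite sFrob_seval; last exact: spow_nat_entire.
by rewrite spow_nat_seval// zpow_repr.
Qed.

(** * Bounds on disks and recovery of coefficients from values *)

Lemma seval_bound a (c : C) : entire p a -> exists2 M : R, 0 < M &
  forall z, absv z <= absv c -> absv (seval p a z) <= M.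
Proof.
move=> ea; have [M M0 hM] := entire_bound c ea; exists M => // z zc.
apply: is_sum_le (ltW M0) (entire_is_sum z ea) _ => e.
apply: le_trans (hM e); have [->|/ea.1 Ee] := eqVneq (a e) 0; first by rewrite !mul0r.
by rewrite !absvM ler_wpM2l ?absv_ge0// zpow_le.
Qed.

(** Since [p ^ M - 1 = -1] is nonzero in C, the polynomial [X^n - 1] is separable and has [n]
    distinct roots; a group of [n] such roots of unity is cyclic. *)
Lemma exists_prim_root M : (0 < M)%N ->
  exists w : C, (p ^ M).-1.-primitive_root w.
Proof.
move=> M0; set n := (p ^ M).-1.
have p1 := prime_gt1 p_prime.
have n0 : (0 < n)%N by rewrite -ltnS prednK ?expn_gt0 ?prime_gt0// -{1}(expn0 p) ltn_exp2l.
have nN1 : n%:R = -1 :> C.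
  apply/eqP; rewrite -addr_eq0 natr1 prednK ?expn_gt0 ?prime_gt0//.
  by rewrite natrX (pcharf0 pcharC) expr0n gtn_eqF.
have [s sE] := closed_field_poly_normal ('X^n - 1 : {poly C}).
have lc : lead_coef ('X^n - 1 : {poly C}) = 1.
  by have /monicP := monicXnsubC (1 : C) n0.
rewrite lc scale1r in sE.
have us : uniq s.
  rewrite -separable_prod_XsubC -sE separable_Xn_sub_1// nN1.
  by rewrite oppr_eq0 oner_eq0.
have /hasP[w _ hw] : has n.-primitive_root s; last by exists w.
apply: cyclic.has_prim_root => //.
  apply/allP => w ws; rewrite /root_of_unity sE root_prod_XsubC//.
have := congr1 (fun P : {poly C} => size P) sE.
by rewrite size_prod_XsubC size_XnsubC// => -[->].
Qed.

Lemma expE_common_denom (A : {fset rat}) : (forall e, e \in A -> expE p e) ->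
  exists k (m : rat -> nat), forall e, e \in A -> e * p%:R ^+ k = (m e)%:R.
Proof.
move=> EA.
have /choice[km hkm] : forall e, exists km : nat * nat,
    e \in A -> e * p%:R ^+ km.1 = km.2%:R.
  move=> e; have [/EA/(expE_nat p_prime)[k [m h]]|] := boolP (e \in A); last by exists (0, 0)%N.
  by exists (k, m).
pose k := (\max_(e <- A) (km e).1)%N.
exists k, (fun e => (km e).2 * p ^ (k - (km e).1))%N => e eA.
by apply: natpX_le (hkm e eA) _; exact: leq_bigmax_seq.
Qed.

(* For a finite partial sum, the coefficient at [e0] is recovered by averaging
   the values against the characters of a group of roots of unity of order
   [p ^ M - 1], which equals [-1] in [C]. *)
Lemma maximum_principle a (c : C) (s : R) : entire p a ->
  (forall z, absv z <= absv c -> absv (seval p a z) <= s) ->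
  forall e, absv (a e * zpow p c e) <= s.
Proof.
move=> ea as_ e0; rewrite leNgt; apply/negP => s_lt.
have s0 : 0 <= s by apply: le_trans (as_ c (lexx _)); exact: absv_ge0.
(* A threshold strictly between [s] and the offending term. It is positive even if [s = 0], so only
   finitely many terms exceed it, the term at [e0] among them. *)
pose r := (s + absv (a e0 * zpow p c e0)) / 2.
have r0 : 0 < r by rewrite /r; lra.
have sr : s <= r by rewrite /r; lra.
have rlt : r < absv (a e0 * zpow p c e0) by rewrite /r; lra.
pose A := fset_set [set e | r < absv (a e * zpow p c e)].
have inA e : (e \in A) = (r < absv (a e * zpow p c e)).
  by rewrite in_fset_set; [apply/idP/idP => [/set_mem|/mem_set]|exact: ea.2].
have EA e : e \in A -> expE p e.
  rewrite inA => h; apply: ea.1; apply: contraTneq h => ->.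
  by rewrite mul0r absv0 -leNgt ltW.
have small z : absv z <= absv c -> absv (\sum_(e <- A) a e * zpow p z e) <= r.
  move=> zc; set S := \sum_(_ <- _) _.
  have -> : S = seval p a z - (seval p a z - S) by ring.
  apply: absvB_le; first exact: le_trans (as_ z zc) sr.
  apply: is_sum_approx (ltW r0) (entire_is_sum z ea) _ => e eA.
  have [->|/ea.1 Ee] := eqVneq (a e) 0; first by rewrite mul0r absv0 ltW.
  rewrite inA -leNgt in eA; apply: le_trans eA.
  by rewrite !absvM ler_wpM2l ?absv_ge0// zpow_le.
have [N [m hm]] := expE_common_denom EA.
have m_inj : {in A &, injective m}.
  move=> d e dA eA /(congr1 (fun i : nat => i%:R : rat)); rewrite -!hm//.
  by apply: mulIf; rewrite expf_neq0.
(* As [M < p ^ M], all cleared exponents [m e] are below [n = p ^ M - 1], so they stay distinct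
   modulo [n]. *)
pose M := (\max_(e <- A) m e).+2.
have mM e : e \in A -> (m e < (p ^ M).-1)%N.
  move=> eA; have le1 : (m e <= \max_(e <- A) m e)%N by exact: leq_bigmax_seq.
  have := ltn_expl M (prime_gt1 p_prime); rewrite /M in le1 *; lia.
have [w hw] := @exists_prim_root M isT; set n := (p ^ M).-1 in mM hw.
have wn1 := prim_expr_order hw.
have n0 := prim_order_gt0 hw.
have w0 : w != 0.
  by apply: contra_eq_neq wn1 => ->; rewrite expr0n gtn_eqF// eq_sym oner_eq0.
have absw : absv w = 1.
  have := congr1 (fun x => absv x) wn1; rewrite absvX absv1 => /eqP.
  by rewrite pexpr_eq1 ?absv_ge0// => /eqP.
have absn : absv (n%:R : C) = 1.
  have -> : n%:R = -1 :> C.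
    apply/eqP; rewrite -addr_eq0 natr1 prednK ?expn_gt0 ?prime_gt0//.
    by rewrite natrX (pcharf0 pcharC) expr0n.
  by rewrite absvN absv1.
have e0A : e0 \in A by rewrite inA.
(* The power [p ^ N] cancels the common denominator: the [e]-th power of [z j] is that of [c] times
   the character value [w ^+ (m e * j)]. *)
pose z j := c * (w ^+ j) ^+ (p ^ N).
have zE j e : e \in A -> zpow p (z j) e = zpow p c e * (w ^+ m e) ^+ j.
  move=> eA; rewrite /z zpowM//; last exact: EA.
  by rewrite (zpow_exprpX _ _ _ (hm e eA))// -!exprM mulnC.
(* Orthogonality of characters: for [e] other than [e0] the sum is geometric with ratio an [n]-th
   root of unity different from 1, hence 0. *)
have orth e : e \in A -> \sum_(j < n) (w ^+ m e0) ^- j * (a e * zpow p (z j) e) =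
    if e == e0 then n%:R * (a e0 * zpow p c e0) else 0.
  move=> eA; case: eqVneq => [->|ee0].
    under eq_bigr => j _.
      rewrite zE// mulrC -!mulrA mulfV; last by rewrite !expf_neq0.
      rewrite mulr1; over.
    by rewrite sumr_const card_ord mulr_natl.
  under eq_bigr => j _.
    have -> : w ^+ m e0 ^- j * (a e * zpow p (z j) e) =
      a e * zpow p c e * (w ^+ m e / w ^+ m e0) ^+ j.
      by rewrite zE// expr_div_n; ring.
    over.
  rewrite -big_distrr/=.
  suff -> : \sum_(j < n) (w ^+ m e / w ^+ m e0) ^+ j = 0 by rewrite mulr0.
  apply/eqP; have := subrX1 (w ^+ m e / w ^+ m e0) n.
  rewrite expr_div_n !(exprAC _ _ n) wn1 !expr1n divr1 subrr => /esym/eqP.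
  rewrite mulf_eq0 => /orP[|//]; rewrite subr_eq0 => /eqP h.
  have /eqP : w ^+ m e = w ^+ m e0.
    by rewrite -[LHS](divfK (expf_neq0 (m e0) w0)) h mul1r.
  rewrite (eq_prim_root_expr hw) !modn_small ?mM// => /eqP/m_inj.
  by move=> /(_ eA e0A) ee; rewrite ee eqxx in ee0.
have avg : \sum_(j < n) (w ^+ m e0) ^- j * (\sum_(e <- A) a e * zpow p (z j) e) =
    n%:R * (a e0 * zpow p c e0).
  under eq_bigr => j _ do rewrite big_distrr/=.
  rewrite exchange_big/= (big_fsetD1 e0)//= orth// eqxx.
  rewrite [X in _ + X]big_seq [X in _ + X]big1 ?addr0// => e.
  by rewrite in_fsetD1 => /andP[/negPf ee0 eA]; rewrite orth// ee0.
have : absv (n%:R * (a e0 * zpow p c e0)) <= r.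
  rewrite -avg; apply: absv_sum_le (ltW r0) _ => j _ _.
  have aw i : absv (w ^+ i) = 1 by rewrite absvX absw expr1n.
  rewrite absvM -exprVn.
  have -> : absv ((w ^+ m e0)^-1 ^+ j) = 1.
    apply: (mulfI (oner_neq0 R)).
    rewrite -[X in X * _](aw (m e0 * j)%N) -absvM exprM -exprMn mulfV ?expf_neq0//.
    by rewrite expr1n absv1 mulr1.
  by rewrite mul1r; apply: small; rewrite /z absvM -exprM aw mulr1.
by rewrite absvM absn mul1r leNgt rlt.
Qed.

(** The maximum principle for the difference at [c = 1] bounds each coefficient by every
    [eps > 0]. *)
Lemma seval_inj a b : entire p a -> entire p b -> seval p a =1 seval p b -> a = b.
Proof.
move=> ea eb ab; apply/funext => e; apply/eqP; rewrite -subr_eq0; apply/eqP.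
apply: absv_le_gt0_eq0 => eps eps0.
have := @maximum_principle _ 1 eps (entireB ea eb) _ e; rewrite zpow1n// mulr1; apply.
by move=> z _; rewrite sevalB// ab subrr absv0 ltW.
Qed.

(** * Composition of entire series *)

Section Composition.
Variables (a b : rat -> C).
Hypotheses (ea : entire p a) (eb : entire p b).

Let h_entire d : a d != 0 -> entire p (spow p b d).
Proof. by move=> _; exact: spow_entire. Qed.

Let h_null z : exists2 v : rat -> C, null_family v &
  forall d e, absv (a d * (spow p b d e * zpow p z e)) <= absv (v d).
Proof.
have [M M0 hM] := seval_bound z eb.
have [c c0 Mc] := disk_cover C M.
(* On the disk of radius [absv z] the values of [b] are at most [absv c], so those of its power with
   exponent [d] are at most [absv (zpow p c d)]. The maximum principle passes this bound to every
   coefficient, uniformly in [e]. *)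
exists (fun d => a d * zpow p c d); first exact: ea.2.
move=> d e; have [->|/ea.1 Ed] := eqVneq (a d) 0; first by rewrite !mul0r.
rewrite !(absvM (a d)) ler_wpM2l ?absv_ge0//.
apply: maximum_principle => [|y yz]; first exact: spow_entire.
by rewrite spow_seval// zpow_le//; exact/Mc/hM.
Qed.

Lemma scomp_entire : entire p (scomp p a b).
Proof. exact: (lincomb_entire h_entire h_null). Qed.

Lemma scomp_seval z : seval p (scomp p a b) z = seval p a (seval p b z).
Proof.
rewrite [LHS](lincomb_seval h_entire h_null); congr tsum.
by apply/funext => d; rewrite spow_seval.
Qed.

End Composition.

(** The representative chosen for [p ^ n] need not be [(1, n)], so the two series are compared
    through their values. *)
Lemma spow_pX b n : entire p b -> spow p b (p%:R ^ n) = sFrob p n b.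
Proof.
move=> eb; apply: seval_inj => [||z]; [exact: spow_entire|exact: sFrob_entire|].
by rewrite spow_seval// sFrob_seval// zpow_pX.
Qed.

(** Outside a finite set [A] the terms at [x] and [y] are dominated by those at [c], which are at
    most [eps]; the terms in [A] are treated one at a time, taking the least [del]. *)
Lemma seval_unif_continuous a (M eps : R) : entire p a -> 0 < eps ->
  exists2 del : R, 0 < del & forall x y, absv x <= M -> absv y <= M ->
    absv (x - y) <= del -> absv (seval p a x - seval p a y) <= eps.
Proof.
move=> ea eps0; have [c c0 Mc] := disk_cover C M.
have [A hA] := null_family_fsetP (ea.2 c) eps0.
have [del del0 hdel] : exists2 del : R, 0 < del & forall d x y, d \in (A : seq rat) ->
    absv x <= M -> absv y <= M -> absv (x - y) <= del ->
    absv (a d * (zpow p x d - zpow p y d)) <= eps.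
  elim: (A : seq rat) => [|d s [del del0 IH]]; first by exists 1.
  have [t t0 ht] := absv_continuousM (a d) eps0.
  have [del' del'0 hd] := zpow_unif_continuous p_prime pcharC M d t0.
  exists (Num.min del del'); first by rewrite lt_min del0.
  move=> d' x y; rewrite inE => /orP[/eqP ->|d's] xM yM; rewrite le_min => /andP[h1 h2].
    exact/ht/hd.
  exact: IH.
exists del => // x y xM yM xy.
apply: is_sum_le (ltW eps0) (is_sumB (entire_is_sum x ea) (entire_is_sum y ea)) _ => d.
rewrite -mulrBr; have [dA|/hA le_eps] := boolP (d \in A); first exact: hdel.
apply: le_trans le_eps; have [->|/ea.1 Ed] := eqVneq (a d) 0; first by rewrite !mul0r.
rewrite !absvM ler_wpM2l ?absv_ge0// absvB_le// zpow_le//; exact: Mc.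
Qed.

Notation P := (perfSeries C p).
Implicit Types (f g : P) (c : C) (s t : R).

Lemma psevalB f g z : seval p (f - g : P) z = seval p f z - seval p g z.
Proof. exact: (sevalB z (entireP f) (entireP g)). Qed.

Lemma psevalD f g z : seval p (f + g : P) z = seval p f z + seval p g z.
Proof. by rewrite -[g in LHS]opprK psevalB -[- g]sub0r psevalB seval0 sub0r opprK. Qed.

Lemma psevalN f z : seval p (- f : P) z = - seval p f z.
Proof. by rewrite -sub0r psevalB seval0 sub0r. Qed.

Lemma pseval_inj f g : seval p f =1 seval p g -> f = g.
Proof.
by move=> fg; apply: perfSeries_eqP => e; rewrite (seval_inj (entireP f) (entireP g) fg).
Qed.

(** * The bounded-open topology and continuity of the operations *)

Definition pclose c s f g : Prop :=
  forall z, absv z <= absv c -> absv (seval p g z - seval p f z) <= s.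

(** Closeness on a disk is closeness of weighted coefficients: one direction is the maximum
    principle, the other the ultrametric inequality. *)
Lemma pcloseP c s f g :
  pclose c s f g <-> forall e, absv ((g e - f e) * zpow p c e) <= s.
Proof.
have e_gf := entireP (g - f); split=> [fg|fg z zc].
  by apply: (maximum_principle e_gf) => z zc; rewrite psevalB; exact: fg.
have s0 := le_trans (absv_ge0 _) (fg 0).
rewrite -psevalB; apply: is_sum_le s0 (entire_is_sum z e_gf) _ => e.
apply: le_trans (fg e); have [->|/e_gf.1 Ee] := eqVneq ((g - f : P) e) 0.
  by rewrite mul0r absv0 absv_ge0.
by rewrite !absvM ler_wpM2l ?absv_ge0// zpow_le.
Qed.

Lemma pclose_Pbase c s f g : Pbase (absv c) s (g - f) <-> pclose c s f g.
Proof.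
split=> [h z zc|h _ [z zc <-]]; last by rewrite /disk/= psevalB; exact: h.
by rewrite -psevalB; apply: h; exists z.
Qed.

Lemma absv_gt0 c : (0 < absv c) = (c != 0).
Proof.
rewrite lt_def absv_ge0 andbT; congr (~~ _).
by apply/eqP/eqP => /absv_eq0.
Qed.

Lemma nbhs_pcloseP f (A : set P) : nbhs f A <->
  exists c s, [/\ c != 0, 0 < s & forall g, pclose c s f g -> A g].
Proof.
rewrite nbhs_perfSeriesE Pnbhs0P; split=> [[r [s [r0 s0 h]]]|[c [s [c0 s0 h]]]].
  have [c c0 rc] := disk_cover C r; exists c, s; split=> // g fg.
  rewrite -(subrK f g) addrC; apply: h => _ [z zr <-].
  by rewrite /disk/= psevalB; apply/fg/rc.
exists (absv c), s; split; rewrite ?absv_gt0// => g hg; apply: h.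
by apply/pclose_Pbase; rewrite addrC addKr.
Qed.

Lemma pcloseD c s f f' g g' : pclose c s f f' -> pclose c s g g' ->
  pclose c s (f + g) (f' + g').
Proof.
move=> ff gg z zc; rewrite !psevalD opprD addrACA.
by apply: absvD_le; [exact: ff|exact: gg].
Qed.

Lemma continuous_pclose2 (op : P -> P -> P) :
  (forall f g c s, c != 0 -> 0 < s -> exists c' t, [/\ c' != 0, 0 < t &
    forall f' g', pclose c' t f f' -> pclose c' t g g' ->
      pclose c s (op f g) (op f' g')]) ->
  continuous (fun fg : P * P => op fg.1 fg.2).
Proof.
move=> h [f g] A /nbhs_pcloseP[c [s [c0 s0 hA]]].
have [c' [t [c'0 t0 ht]]] := h f g c s c0 s0.
exists (pclose c' t f, pclose c' t g).
  by split; apply/nbhs_pcloseP; exists c', t; split.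
by move=> [f' g'] [/= ff gg]; apply: hA; exact: ht.
Qed.

Lemma padd_continuous : continuous (fun fg : P * P => fg.1 + fg.2).
Proof.
apply: continuous_pclose2 => f g c s c0 s0; exists c, s; split=> // f' g'.
exact: pcloseD.
Qed.

Lemma popp_continuous : continuous (fun f : P => - f).
Proof.
move=> f A /nbhs_pcloseP[c [s [c0 s0 hA]]]; apply/nbhs_pcloseP.
exists c, s; split=> // g fg; apply: hA => z zc.
by rewrite !psevalN -opprD absvN; exact: fg.
Qed.

Definition pmul f g : P := mkSeries (smul_entire (entireP f) (entireP g)).
Definition pcomp f g : P := mkSeries (scomp_entire (entireP f) (entireP g)).

Lemma pmul_seval f g z : seval p (pmul f g) z = seval p f z * seval p g z.
Proof. exact: smul_seval (entireP f) (entireP g) z. Qed.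

Lemma pcomp_seval f g z : seval p (pcomp f g) z = seval p f (seval p g z).
Proof. exact: scomp_seval (entireP f) (entireP g) z. Qed.

Lemma pmul_continuous : continuous (fun fg : P * P => pmul fg.1 fg.2).
Proof.
apply: continuous_pclose2 => f g c s c0 s0.
have [M M0 hM] := seval_bound c (entireP f).
have [N N0 hN] := seval_bound c (entireP g).
(* [K] bounds [f] and [g] on the disk, and also [g']: the tolerance is at most 1, hence at most
   [K]. *)
pose K := Num.max 1 (Num.max M N).
have K1 : 1 <= K by rewrite le_max lexx.
have K0 : 0 < K by rewrite (lt_le_trans ltr01).
exists c, (Num.min 1 (s / K)); split=> //.
  by rewrite lt_min ltr01 divr_gt0.
move=> f' g' ff gg z zc; rewrite !pmul_seval.
have := ff z zc; have := gg z zc; rewrite !le_min => /andP[g1 gs] /andP[f1 fs].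
have fK : absv (seval p f z) <= K by rewrite !le_max hM// orbT.
have gK : absv (seval p g z) <= K by rewrite !le_max hN// !orbT.
move: (seval p f z) (seval p f' z) (seval p g z) (seval p g' z) f1 fs g1 gs fK gK.
move=> x x' y y' f1 fs g1 gs fK gK.
have y'K : absv y' <= K.
  by rewrite -(subrK y y'); apply: absvD_le => //; exact: le_trans K1.
have -> : x' * y' - x * y = (x' - x) * y' + (y' - y) * x by ring.
have sE : s = s / K * K by rewrite divfK// gt_eqF.
by apply: absvD_le; rewrite absvM [leRHS]sE ler_pM ?absv_ge0.
Qed.

Lemma pcomp_continuous : continuous (fun fg : P * P => pcomp fg.1 fg.2).
Proof.
apply: continuous_pclose2 => f g c s c0 s0.
have [M M0 hM] := seval_bound c (entireP g).
have [del del0 hdel] := seval_unif_continuous (Num.max 1 M) (entireP f) s0.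
(* The larger disk must contain both [z] and [g'(z)]: [f'] is compared with [f] at the point
   [g'(z)], then [f] at [g'(z)] with [f] at [g(z)] by uniform continuity. *)
have [c' c'0 hc'] := disk_cover C (Num.max (absv c) (Num.max 1 M)).
exists c', (Num.min s (Num.min 1 del)); split=> //.
  by rewrite !lt_min s0 ltr01.
move=> f' g' ff gg z zc; rewrite !pcomp_seval.
have zc' : absv z <= absv c' by apply: hc'; rewrite /disk/= le_max zc.
have := gg z zc'; rewrite !le_min => /and3P[_ g1 gdel].
have gM : absv (seval p g z) <= Num.max 1 M by rewrite le_max hM// orbT.
have g'M : absv (seval p g' z) <= Num.max 1 M.
  rewrite -(subrK (seval p g z) (seval p g' z)).
  by apply: absvD_le => //; rewrite le_max g1.
rewrite -(subrKA (seval p f (seval p g' z))); apply: absvD_le; last exact: hdel.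
have /ff : absv (seval p g' z) <= absv c' by apply: hc'; rewrite /disk/= le_max g'M orbT.
by rewrite le_min => /andP[].
Qed.

(** * Completeness of the space of series *)

Lemma cauchy_pclose (G : set_system P) : ProperFilter G -> cauchy G ->
  forall c s, c != 0 -> 0 < s ->
    exists2 A, G A & forall f g, A f -> A g -> pclose c s f g.
Proof.
move=> GF Gc c s c0 s0.
have /Gc[[U V] [/= GU GV] UV] : entourage [set fg : P * P | pclose c s fg.1 fg.2].
  exists (Pbase (absv c) s).
    by apply/Pnbhs0P; exists (absv c), s; split; rewrite ?absv_gt0.
  by move=> fg /= /pclose_Pbase.
exists (U `&` V); first exact: filterI.
by move=> f g [Uf _] [_ Vg]; exact: (UV (f, g)).
Qed.

Lemma pclose_coef s f g e : pclose 1 s f g -> absv (g e - f e) <= s.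
Proof. by move=> /pcloseP/(_ e); rewrite zpow1n// mulr1. Qed.

(** The bound is uniform in [e], which makes the coefficientwise limit a limit in the topology. The
    limit is that of a sequence [x n] picked from sets of the filter of diameter at most
    [1 / (n + 1)] at radius 1. *)
Lemma cauchy_coef_limit (G : set_system P) : ProperFilter G -> cauchy G ->
  exists l : rat -> C, forall c s, c != 0 -> 0 < s ->
    exists2 A, G A & forall f e, A f -> absv ((f e - l e) * zpow p c e) <= s.
Proof.
move=> GF Gc; have Gclose := cauchy_pclose GF Gc.
have inv0 (n : nat) : 0 < n.+1%:R^-1 :> R by rewrite invr_gt0.
have small (e : R) : 0 < e -> exists N : nat, forall n : nat, (N <= n)%N -> n.+1%:R^-1 < e.
  move=> e0; exists (Num.truncn e^-1) => n Nn.
  rewrite -[ltRHS]invrK ltf_pV2 ?posrE ?invr_gt0//.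
  by rewrite (lt_le_trans (truncnS_gt _))// ler_nat ltnS.
have /choice[A hA] : forall n : nat, exists A, G A /\
    forall f g, A f -> A g -> pclose 1 (n.+1%:R^-1 : R) f g.
  by move=> n; have [A GA hA] := Gclose 1 _ (oner_neq0 C) (inv0 n); exists A.
have /choice[x Ax] : forall n : nat, exists f, A n f.
  by move=> n; have [f Af] := filter_ex (hA n).1; exists f.
have xcauchy e (eps : R) : 0 < eps -> exists N : nat, forall m n : nat,
    (N <= m)%N -> (N <= n)%N -> absv (x m e - x n e) < eps.
  move=> /small[N hN]; exists N => m n /hN hm /hN hn.
  have [f [Amf Anf]] := filter_ex (filterI (hA m).1 (hA n).1).
  rewrite -(subrKA (f e)); apply: absvD_lt.
    exact: le_lt_trans (pclose_coef _ ((hA m).2 _ _ Amf (Ax m))) hm.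
  exact: le_lt_trans (pclose_coef _ ((hA n).2 _ _ (Ax n) Anf)) hn.
have /choice[l hl] : forall e, exists l : C, forall eps : R, 0 < eps ->
    exists N : nat, forall n : nat, (N <= n)%N -> absv (x n e - l) < eps.
  by move=> e; exact: (@absv_complete R C (fun n : nat => x n e) (xcauchy e)).
exists l => c s c0 s0; have [B GB hB] := Gclose c s c0 s0; exists B => // f e Bf.
have [t t0 ht] := absv_continuousM (zpow p c e) s0.
have [N hN] := hl e t t0; have [N' hN'] := small t t0.
(* The index [n] and the intermediate series [g] may depend on [e], but the set [B] does not, nor
   does the bound [s]. *)
pose n := maxn N N'.
have [g [Bg Ang]] := filter_ex (filterI GB (hA n).1).
have -> : (f e - l e) * zpow p c e = (f e - g e) * zpow p c e +
  (zpow p c e * (g e - x n e) + zpow p c e * (x n e - l e)) by ring.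
apply: absvD_le; first by have /pcloseP := hB _ _ Bg Bf; exact.
apply: absvD_le; apply: ht; last exact/ltW/hN/leq_maxl.
rewrite (le_trans (pclose_coef _ ((hA n).2 _ _ (Ax n) Ang)))//.
exact/ltW/hN'/leq_maxr.
Qed.

(** The second clause controls the support of the limit; it is what shows that a limit of series
    with exponents [q ^ n] is again of this kind. *)
Lemma perfSeries_complete (G : set_system P) : ProperFilter G -> cauchy G ->
  exists2 l : P, G --> l &
    forall B, G B -> forall e, l e != 0 -> exists2 f, B f & f e != 0.
Proof.
move=> GF Gc; have [l hl] := cauchy_coef_limit GF Gc.
have lB B : G B -> forall e, l e != 0 -> exists2 f : P, B f & f e != 0.
  move=> GB e le0; have le_gt0 : 0 < absv (l e) / 2 by rewrite divr_gt0 ?absv_gt0.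
  have [A GA hA] := hl 1 _ (oner_neq0 C) le_gt0.
  have [f [Bf Af]] := filter_ex (filterI GB GA); exists f => //.
  apply: contraTneq le_gt0 => f0; have := hA f e Af.
  by rewrite f0 sub0r zpow1n// mulr1 absvN -leNgt; lra.
have el : entire p l.
  have El e : l e != 0 -> expE p e.
    by move=> /(lB _ filterT)[f _]; exact: (entireP f).1.
  split=> // z; have [c c0 zc] := disk_cover C (absv z).
  have /null_family_le : null_family (fun e => l e * zpow p c e); last first.
    apply => e; have [->|/El Ee] := eqVneq (l e) 0; first by rewrite !mul0r.
    by rewrite !absvM ler_wpM2l ?absv_ge0// zpow_le//; apply: zc; rewrite /disk/=.
  apply: fsetP_null_family => r r0; have [A GA hA] := hl c r c0 r0.
  have [f Af] := filter_ex GA.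
  have [B hB] := null_family_fsetP ((entireP f).2 c) r0; exists B => e /hB fB.
  have -> : l e * zpow p c e = f e * zpow p c e - (f e - l e) * zpow p c e by ring.
  by apply: absvB_le => //; exact: hA.
exists (mkSeries el) => // A /nbhs_pcloseP[c [s [c0 s0 hA]]].
have [B GB hB] := hl c s c0 s0; apply: filterS GB => f Bf; apply: hA.
by apply/pcloseP => e; exact: hB.
Qed.

Lemma pmul_complete_ring : complete_topological_ring setT pmul.
Proof.
split=> //.
- by move=> f g h _ _ _; apply: pseval_inj => z; rewrite !pmul_seval mulrA.
- by move=> f g h _ _ _; apply: pseval_inj => z; rewrite psevalD !pmul_seval psevalD mulrDl.
- by move=> f g h _ _ _; apply: pseval_inj => z; rewrite psevalD !pmul_seval psevalD mulrDr.
- exists (mkSeries (monomial_entire (expE0 p))); split=> // f _.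
  split; apply: pseval_inj => z; rewrite pmul_seval [seval p (mkSeries _) z]monomial_seval.
    by rewrite zpow0// mul1r.
  by rewrite zpow0// mulr1.
- exact/continuous_subspaceT/padd_continuous.
- exact/continuous_subspaceT/popp_continuous.
- exact/continuous_subspaceT/pmul_continuous.
- by move=> G GF _ /(perfSeries_complete GF)[l Gl _]; exists l.
Qed.

(** * The ring of series whose exponents are powers of q *)

Section Additive.
Variables (k q : nat).
Hypothesis qE : q = (p ^ k)%N.

Lemma qX_pX n : q%:R ^ n = p%:R ^ (k%:Z * n) :> rat.
Proof. by rewrite qE natrX -exprz_exp. Qed.

(** Every term is a constant times a Frobenius map, hence additive. This yields distributivity of
    composition over a sum in its right argument. *)
Lemma Fseries_sevalD f x y : Fseries q f ->
  seval p f (x + y) = seval p f x + seval p f y.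
Proof.
move=> Ff; apply: tsumP.
have := is_sumD (entire_is_sum x (entireP f)) (entire_is_sum y (entireP f)).
congr is_sum; apply/funext => d; have [->|/Ff[n ->]] := eqVneq (f d) 0.
  by rewrite !mul0r addr0.
rewrite -mulrDr qX_pX !zpow_pX//; congr (_ * _).
have FB := FrobB p_prime pcharC (k%:Z * n).
have F0 : Frob p (k%:Z * n) 0 = 0 :> C by have := FB 0 0; rewrite !subrr.
by rewrite -[y in RHS]opprK FB -[- y]sub0r FB F0 sub0r opprK.
Qed.

Lemma Fseries_comp f g : Fseries q f -> Fseries q g -> Fseries q (pcomp f g).
Proof.
move=> Ff Fg e /tsum_neq0[d]; rewrite mulf_eq0 negb_or => /andP[/Ff[n ->]].
rewrite qX_pX spow_pX; last exact: entireP.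
rewrite /sFrob Frob_eq0// -qX_pX => /Fg[j ej]; exists (j + n).
have q0 : q%:R != 0 :> rat by rewrite qE natrX expf_neq0.
by rewrite expfzDr// -ej divfK// expfz_neq0.
Qed.

Lemma Fseries_complete_ring : complete_topological_ring (@Fseries R C p q) pcomp.
Proof.
split.
- by move=> e /eqP.
- move=> f g Ff Fg e; have [f0|/Ff//] := eqVneq (f e) 0.
  have [g0|/Fg//] := eqVneq (g e) 0.
  have -> : (f - g : P) e = f e - g e by [].
  by rewrite f0 g0 subrr eqxx.
- exact: Fseries_comp.
- by move=> f g h _ _ _; apply: pseval_inj => z; rewrite !pcomp_seval.
- by move=> f g h _ _ _; apply: pseval_inj => z; rewrite psevalD !pcomp_seval psevalD.
- move=> f g h Ff _ _; apply: pseval_inj => z.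
  by rewrite psevalD !pcomp_seval psevalD Fseries_sevalD.
(* The unit for composition is the series [z], the monomial of exponent [1 = q ^ 0]. *)
- have E1 : expE p 1 by exists 1%N, 0; rewrite mulr1.
  exists (mkSeries (monomial_entire E1)).
  have idE z : seval p (mkSeries (monomial_entire E1)) z = z.
    by rewrite [LHS]monomial_seval zpow1.
  split=> [e|f _].
    by rewrite /= /monomial; case: (eqVneq e 1) => [->|_]; [exists 0|rewrite eqxx].
  by split; apply: pseval_inj => z; rewrite pcomp_seval idE.
- exact/continuous_subspaceT/padd_continuous.
- exact/continuous_subspaceT/popp_continuous.
- exact/continuous_subspaceT/pcomp_continuous.
- move=> G GF GA /(perfSeries_complete GF)[l Gl lF]; exists l => // e.
  by move=> /(lF _ GA)[f Ff /Ff].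
Qed.

End Additive.

End Evaluation.

Theorem theorem3p3 (R : realType) (C : completeNAField R) (p k q : nat)
    (p_prime : prime p) (k_gt0 : (0 < k)%N) (qE : q = (p ^ k)%N)
    (Fq : finFieldType) (card_Fq : #|Fq| = q) (iota : {rmorphism Fq -> C}) :
  exists mul comp : perfSeries C p -> perfSeries C p -> perfSeries C p,
    [/\ forall f g, coef (mul f g) = smul f g,
        forall f g, coef (comp f g) = scomp p f g,
        complete_topological_ring setT mul,
        continuous (fun fg : perfSeries C p * perfSeries C p =>
                      comp fg.1 fg.2)
      & complete_topological_ring (@Fseries R C p q) comp].
Proof.
(* The characteristic of the finite field with [p ^ k] elements is carried to C along [iota]. *)
have pcharC : p \in [pchar C].
  have /(rmorph_pchar iota) : p \in [pchar Fq] by apply: card_finPcharP p_prime; rewrite card_Fq qE.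
  exact.
exists (pmul p_prime pcharC), (pcomp p_prime pcharC); split=> //.
- exact: pmul_complete_ring.
- exact: pcomp_continuous.
- exact: (Fseries_complete_ring _ _ qE).
Qed.
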